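(* Let $\delta > 0$ and let $x,y \in \mathbb{C}^L$ be $B$-bandlimited, for some $B \in \mathbb{N}_0$. For $G_\delta = (V_\delta,E)$ the essential support graph of $x$, assume that the subgraph of $G_\delta$ induced by the vertex set $S_\delta = V_\delta \cap \operatorname{supp} y$ is connected. If $\phi \in \mathbb{C}^L$ is such that $$\min_{\substack{m \in \{0,1\}\\ n \in \{-2B,\dots,2B\}}} \lvert \mathcal{A}[\phi](m,n)\rvert \geq \frac{1}{c}$$ for some $c > 0$, then $$\inf_{\alpha \in \mathbb{R}} \left\lVert x - \mathrm{e}^{\mathrm{i}\alpha} y\right\rVert_{\ell^2(V_\delta)} \leq \frac{c}{\delta}\left(1 + \frac{\sqrt{2\lvert S_\delta\rvert}\, \lVert x\rVert_{\ell^2(S_\delta)}}{\delta}\right)\left\lVert M_\phi[x]-M_\phi[y]\right\rVert_{\mathrm{F}}.$$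
   Context: Fix $L \in \mathbb{N}$. Vectors in $\mathbb{C}^L$ are indexed by $\{0,\dots,L-1\}$, and all indexing (of vectors and of $L\times L$ arrays) is periodic modulo $L$, e.g. $\phi(\ell) = \phi(\ell \bmod L)$ for $\ell \in \mathbb{Z}$. The support is $\operatorname{supp} x = \{\ell \in \{0,\dots,L-1\} : x(\ell) \neq 0\}$. The discrete Fourier transform (DFT) is $\mathcal{F}[x](k) = \frac{1}{\sqrt{L}}\sum_{\ell=0}^{L-1} x(\ell)\mathrm{e}^{-2\pi\mathrm{i}\ell k/L}$. The discrete Gabor transform of $x \in \mathbb{C}^L$ with window $\phi \in \mathbb{C}^L$ is $\mathcal{V}_\phi[x](m,n) = \frac{1}{\sqrt{L}} \sum_{\ell=0}^{L-1} x(\ell)\overline{\phi(\ell-m)}\mathrm{e}^{-2\pi\mathrm{i}\ell n/L}$, $m,n = 0,\dots,L-1$. The ambiguity function is $\mathcal{A}[x] := \mathcal{V}_x[x]$, and the measurements are $M_\phi[x](m,n) := \lvert \mathcal{V}_\phi[x](m,n)\rvert^2$, $m,n=0,\dots,L-1$. $\lVert\cdot\rVert_{\mathrm{F}}$ is the Frobenius norm of $L\times L$ matrices. For $B \in \mathbb{N}_0$, $x \in \mathbb{C}^L$ is $B$-bandlimited if $\operatorname{supp} \mathcal{F}[x] \subset \{-B,\dots,B\} \bmod L$. For $S \subset \{0,\dots,L-1\}$, $\lVert x \rVert_{\ell^2(S)} = \left(\sum_{\ell \in S} \lvert x(\ell)\rvert^2\right)^{1/2}$, and $\lvert S\rvert$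 is the cardinality of $S$. For $\delta > 0$, the essential support graph of $x$ (with time separation parameter zero) is the graph $G_\delta = (V_\delta,E)$ with vertex set $V_\delta = \{\ell \in \{0,\dots,L-1\} : \lvert x(\ell)\rvert \geq \delta\}$ and an edge between $\ell,k \in V_\delta$ if $\lvert \ell-k\rvert \in (0,1] \cup [L-1,L)$. *)

(* Defs.v *)
From HB Require Import structures.
From mathcomp Require Import all_boot all_order all_algebra.
From mathcomp Require Import all_classical all_reals all_analysis.
From mathcomp Require Import complex.

Set Implicit Arguments.
Unset Strict Implicit.
Unset Printing Implicit Defensive.

Import Order.TTheory GRing.Theory Num.Theory.
Local Open Scope ring_scope.
Local Open Scope complex_scope.

(* The norm `|z| of z : R[i] is itself an element of R[i]; [cabs] takes its
   values in R. *)
Definition cabs (R : realType) (z : R[i]) : R := complex.Re `|z|.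

(* exp (i t) *)
Definition cis (R : realType) (t : R) : R[i] := cos t +i* sin t.

(* Indexing modulo L.  Since (z %% L)%Z lies in {0, ..., L-1} when 0 < L, the
   default value 0 is only reached when L = 0. *)
Definition vec_at (R : realType) (L : nat) (x : 'cV[R[i]]_L) (z : int) : R[i] :=
  if (insub `|(z %% L%:Z)%Z|%N : option 'I_L) is Some l then x l 0 else 0.

Definition mx_at (R : realType) (L : nat) (A : 'M[R[i]]_L) (m n : int) : R[i] :=
  if (insub `|(m %% L%:Z)%Z|%N : option 'I_L) is Some i
  then vec_at (row i A)^T n else 0.

Definition supp (R : realType) (L : nat) (x : 'cV[R[i]]_L) : {set 'I_L} :=
  [set l | x l 0 != 0].

Definition dft (R : realType) (L : nat) (x : 'cV[R[i]]_L) : 'cV[R[i]]_L :=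
  \col_(k < L) (((Num.sqrt L%:R : R)^-1)%:C *
    \sum_(l < L) x l 0 * cis (- (2 * pi * l%:R * k%:R / L%:R))).

Definition gabor (R : realType) (L : nat) (phi x : 'cV[R[i]]_L) : 'M[R[i]]_L :=
  \matrix_(m < L, n < L) (((Num.sqrt L%:R : R)^-1)%:C *
    \sum_(l < L) x l 0 * (vec_at phi (l%:Z - m%:Z))^*
                 * cis (- (2 * pi * l%:R * n%:R / L%:R))).

Definition ambiguity (R : realType) (L : nat) (x : 'cV[R[i]]_L) : 'M[R[i]]_L :=
  gabor x x.

Definition measurements (R : realType) (L : nat) (phi x : 'cV[R[i]]_L) :
    'M[R]_L :=
  \matrix_(m < L, n < L) cabs (gabor phi x m n) ^+ 2.

Definition frobenius (R : realType) (L : nat) (A : 'M[R]_L) : R :=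
  Num.sqrt (\sum_(m < L) \sum_(n < L) `|A m n| ^+ 2).

Definition bandlimited (R : realType) (L B : nat) (x : 'cV[R[i]]_L) : Prop :=
  forall k : 'I_L, k \in supp (dft x) ->
    exists2 j : int, - B%:Z <= j <= B%:Z & (k%:Z = j %[mod L%:Z])%Z.

Definition l2norm (R : realType) (L : nat) (S : {set 'I_L})
    (x : 'cV[R[i]]_L) : R :=
  Num.sqrt (\sum_(l in S) cabs (x l 0) ^+ 2).

Definition ess_vertices (R : realType) (L : nat) (delta : R)
    (x : 'cV[R[i]]_L) : {set 'I_L} :=
  [set l | delta <= cabs (x l 0)].

Definition ess_edge (R : realType) (L : nat) (delta : R)
    (x : 'cV[R[i]]_L) : rel 'I_L :=
  [rel l k | [&& l \in ess_vertices delta x, k \in ess_vertices delta x &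
    let d := `|l%:Z - k%:Z| in
    (0 < d <= 1) || (L%:Z - 1 <= d < L%:Z)]].

Definition induced (T : finType) (e : rel T) (S : {set T}) : rel T :=
  [rel u v | [&& u \in S, v \in S & e u v]].

(* The empty vertex set counts as connected. *)
Definition induced_connected (T : finType) (e : rel T) (S : {set T}) : Prop :=
  {in S &, forall u v, connect (induced e S) u v}.

(* Main.v *)
(* Taking the two-dimensional Fourier transform of the spectrogram |V_phi x|^2
   gives, up to normalisation, A[x] times the conjugate of A[phi].  For fixed
   shift s, A[x](s, .) is the Fourier transform of l |-> x(l + s) conj(x(l)),
   which is 2B-bandlimited; hence the lower bound on A[phi] and Parseval control
   the l2 norm of x(. + s) conj(x) - y(. + s) conj(y) by c |M[x] - M[y]|_F, for
   s = 0 and s = 1.  The case s = 0 controls the moduli; s = 1 controls the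
   variation of the relative phase of x and y along an edge of the support
   graph.  A connected S is an arc of Z/L, so measuring phases from its midpoint
   costs at most |S|/2 edges; by Cauchy-Schwarz this gives the factor
   2 sqrt(|S|/2) = sqrt(2|S|). *)

Require Import Defs.
From mathcomp Require Import all_boot all_order all_algebra.
From mathcomp Require Import all_classical all_reals all_analysis.
From mathcomp Require Import complex.
From mathcomp Require Import ring lra zify.

Set Implicit Arguments.
Unset Strict Implicit.
Unset Printing Implicit Defensive.

Import Order.TTheory GRing.Theory Num.Theory.
Local Open Scope classical_set_scope.
Local Open Scope ring_scope.

(** * Cauchy-Schwarz and Minkowski for finite real sums *)

Section SumInequalities.
Variables (R : realType) (I : Type) (r : seq I) (P : pred I).
Implicit Types a b : I -> R.

(** Lagrange's identity: twice the defect in Cauchy-Schwarz is the double sum of the squares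
    [(a i * b j - a j * b i) ^+ 2]. *)
Lemma sqr_sum_mul_le a b :
  (\sum_(i <- r | P i) a i * b i) ^+ 2 <=
  (\sum_(i <- r | P i) a i ^+ 2) * (\sum_(i <- r | P i) b i ^+ 2).
Proof.
have lagrange : 0 <= \sum_(i <- r | P i) \sum_(j <- r | P j)
    (a i * b j - a j * b i) ^+ 2.
  by apply: sumr_ge0 => i _; apply: sumr_ge0 => j _; exact: sqr_ge0.
suff eq_lagrange :
   ((\sum_(i <- r | P i) a i ^+ 2) * (\sum_(i <- r | P i) b i ^+ 2) -
   (\sum_(i <- r | P i) a i * b i) ^+ 2) *+ 2 =
   \sum_(i <- r | P i) \sum_(j <- r | P j) (a i * b j - a j * b i) ^+ 2.
  by move: lagrange; rewrite -eq_lagrange pmulrn_lge0 // subr_ge0.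
under [RHS]eq_bigr => i _.
  under eq_bigr => j _.
    have -> : (a i * b j - a j * b i) ^+ 2 =
      a i ^+ 2 * b j ^+ 2 - 2 * (a i * b i) * (a j * b j) + b i ^+ 2 * a j ^+ 2.
      by ring.
    over.
  rewrite big_split sumrB -!mulr_sumr.
  over.
rewrite big_split sumrB -!mulr_suml -mulr_sumr /=; ring.
Qed.

Lemma sqr_sum_le_sum_sqr a :
  (\sum_(i <- r | P i) a i) ^+ 2 <=
  (\sum_(i <- r | P i) 1) * \sum_(i <- r | P i) a i ^+ 2.
Proof.
have := sqr_sum_mul_le (fun=> 1) a.
by under [X in X ^+ 2 <= _]eq_bigr do rewrite mul1r;
   under [X in _ <= X * _]eq_bigr do rewrite expr1n.
Qed.

(** Minkowski's inequality: after squaring and expanding, only the cross term remains, and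
    Cauchy-Schwarz bounds it. *)
Lemma sqrt_sum_sqrD_le a b :
  Num.sqrt (\sum_(i <- r | P i) (a i + b i) ^+ 2) <=
  Num.sqrt (\sum_(i <- r | P i) a i ^+ 2) +
  Num.sqrt (\sum_(i <- r | P i) b i ^+ 2).
Proof.
have sum_sqr_ge0 c : 0 <= \sum_(i <- r | P i) c i ^+ 2 :> R.
  by apply: sumr_ge0 => i _; exact: sqr_ge0.
rewrite -[leRHS]ger0_norm ?addr_ge0 ?sqrtr_ge0 // -sqrtr_sqr.
rewrite ler_wsqrtr // sqrrD !sqr_sqrtr //.
under eq_bigr do rewrite sqrrD.
rewrite !big_split /= -mulr2n lerD2r lerD2l lerMn2r /= -sqrtrM //.
apply: le_trans (ler_norm _) _.
by rewrite -sqrtr_sqr ler_wsqrtr // sqr_sum_mul_le.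
Qed.

End SumInequalities.

(** * The real-valued modulus, the unit circle and directions of complex numbers *)

Section ComplexModulus.
Variable R : realType.
Local Open Scope complex_scope.
Local Open Scope ring_scope.
Implicit Types (z w : R[i]) (s t : R).

Lemma cabsE z : (cabs z)%:C = `|z|.
Proof. by rewrite /cabs normc_def. Qed.

Lemma cabs_ge0 z : 0 <= cabs z.
Proof. by rewrite -ler0c cabsE. Qed.

Lemma cabsM z w : cabs (z * w) = cabs z * cabs w.
Proof. by apply: complexI; rewrite rmorphM /= !cabsE normrM. Qed.

Lemma cabsJ z : cabs z^* = cabs z.
Proof. by apply: complexI; rewrite !cabsE norm_conjC. Qed.

Lemma cabsD z w : cabs (z + w) <= cabs z + cabs w.
Proof. by rewrite -lecR rmorphD /= !cabsE ler_normD. Qed.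

Lemma cabsN z : cabs (- z) = cabs z.
Proof. by apply: complexI; rewrite !cabsE normrN. Qed.

Lemma cabs0 : cabs (0 : R[i]) = 0.
Proof. by apply: complexI; rewrite !cabsE normr0. Qed.

Lemma cabs_eq0 z : (cabs z == 0) = (z == 0).
Proof. by rewrite -(inj_eq (@complexI R)) cabsE normr_eq0. Qed.

Lemma cabs_real s : cabs s%:C = `|s|.
Proof. by rewrite /cabs normc_def /= expr0n addr0 sqrtr_sqr. Qed.

Lemma cabs_sqr z : (cabs z ^+ 2)%:C = z * z^*.
Proof. by rewrite rmorphXn /= cabsE normCK. Qed.

Lemma cabs_dist_norm z w : `|cabs z - cabs w| <= cabs (z - w).
Proof.
have := cabsD (z - w) w; have := cabsD (w - z) z.
rewrite !subrK -[cabs (w - z)]cabsN opprB => h1 h2.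
by rewrite ler_norml; apply/andP; split; lra.
Qed.

Lemma cabs_sum_le (I : Type) (r : seq I) (P : pred I) (f : I -> R[i]) :
  cabs (\sum_(i <- r | P i) f i) <= \sum_(i <- r | P i) cabs (f i).
Proof.
elim/big_ind2: _ => [|u1 v1 u2 v2 h1 h2|//]; first by rewrite cabs0.
exact: le_trans (cabsD _ _) (lerD h1 h2).
Qed.

Lemma cisD s t : cis (s + t) = cis s * cis t.
Proof.
rewrite /cis cosD sinD; apply/eqP; rewrite eq_complex /= eqxx /=.
by apply/eqP; ring.
Qed.

Lemma cisN t : cis (- t) = (cis t)^*.
Proof. by rewrite /cis cosN sinN. Qed.

Lemma cis0 : cis 0 = 1 :> R[i].
Proof. by rewrite /cis cos0 sin0. Qed.

Lemma cabs_cis t : cabs (cis t) = 1.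
Proof. by rewrite /cabs normc_def /= cos2Dsin2 sqrtr1. Qed.

Lemma cis2pi_int (n : int) : cis (2 * pi * n%:~R) = 1 :> R[i].
Proof.
have nat_case (m : nat) : cis (2 * pi * m%:R) = 1 :> R[i].
  elim: m => [|m IHm]; first by rewrite mulr0 cis0.
  rewrite -[m.+1%:R]natr1 mulrDr cisD IHm mul1r mulr1 /cis mulr_natl.
  by rewrite cos2pi sin2pi.
case: (intP n) => [|m|m]; first by rewrite mulr0 cis0.
  exact: nat_case.
by rewrite rmorphN mulrN cisN nat_case conjC1.
Qed.

(** The real part is [1 - 2 * sin (t / 2) ^+ 2], and the sine is positive because [t / 2] lies
    strictly between 0 and pi. *)
Lemma cis_neq1 t : 0 < t < 2 * pi -> cis t != 1.
Proof.
move=> /andP[t0 t2]; rewrite eq_complex /= negb_and; apply/orP; left.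
have -> : t = (t / 2) *+ 2 by rewrite -mulr_natr divfK.
rewrite cos_mulr2n cos2sin2.
have : 0 < sin (t / 2) by apply: sin_gt0_pi; lra.
move=> s0; have : 0 < sin (t / 2) ^+ 2 by rewrite exprn_gt0.
by move=> s2; apply/eqP; lra.
Qed.

(** The arccosine of the real part is the angle up to sign; the sign of the imaginary part
    decides. *)
Lemma cis_surj z : cabs z = 1 -> exists t, z = cis t.
Proof.
case: z => a b; rewrite /cabs normc_def /= => h.
have hab : a ^+ 2 + b ^+ 2 = 1.
  by rewrite -[LHS]sqr_sqrtr ?h ?expr1n // addr_ge0 // sqr_ge0.
have a1 : -1 <= a <= 1.
  have a21 : a ^+ 2 <= 1 by have := sqr_ge0 b; lra.
  by apply/andP; split; nra.
have sinE : sin (acos a) = `|b|.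
  by rewrite sin_acos // -sqrtr_sqr; congr Num.sqrt; lra.
have cosE : cos (acos a) = a by rewrite acosK // in_itv.
case: (leP 0 b) => hb.
  by exists (acos a); rewrite /cis cosE sinE ger0_norm.
by exists (- acos a); rewrite /cis cosN sinN cosE sinE ltr0_norm // opprK.
Qed.

(** The phase factor of [z]. It is 0 at 0, so the polar decomposition [directionE] holds for every
    [z]. *)
Definition direction z : R[i] := z / (cabs z)%:C.

Lemma directionE z : z = (cabs z)%:C * direction z.
Proof.
have [->|z0] := eqVneq z 0; first by rewrite cabs0 mul0r.
by rewrite mulrC divfK // fmorph_eq0 cabs_eq0.
Qed.

Lemma cabs_direction z : z != 0 -> cabs (direction z) = 1.
Proof.
move=> z0; rewrite /direction cabsM -fmorphV cabs_real ger0_norm.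
  by rewrite divff // cabs_eq0.
by rewrite invr_ge0 cabs_ge0.
Qed.

(* With [w' = (|z| / |w|) w] one has [|z - w'| <= |z - w| + |w - w'|] and
   [|w - w'| = ||w| - |z|| <= |z - w|]. *)
Lemma direction_dist z w : z != 0 -> w != 0 ->
  cabs z * cabs (direction z - direction w) <= 2 * cabs (z - w).
Proof.
move=> z0 w0.
have az : (cabs z)%:C != 0 by rewrite cabsE normr_eq0.
have aw : (cabs w)%:C != 0 by rewrite cabsE normr_eq0.
have -> : cabs z * cabs (direction z - direction w) =
    cabs ((z - w) + (cabs w - cabs z)%:C * direction w).
  rewrite -{1}(ger0_norm (cabs_ge0 z)) -cabs_real -cabsM; congr cabs.
  by rewrite /direction rmorphB /=; field; rewrite az aw.
apply: le_trans (cabsD _ _) _.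
rewrite cabsM cabs_direction // mulr1 cabs_real mulr_natl mulr2n lerD2l distrC.
exact: cabs_dist_norm.
Qed.

End ComplexModulus.

(** * Fourier analysis of L-periodic functions on the integers *)

Section PeriodicFourier.
Variables (R : realType) (L : nat).
Hypothesis L_gt0 : (0 < L)%N.
Local Open Scope complex_scope.
Local Open Scope ring_scope.
Implicit Types (f g : int -> R[i]) (z s k : int).

Definition character z : R[i] := cis (2 * pi * z%:~R / L%:R).

Definition modperiodic f := forall z, f (z + L%:Z) = f z.

(** Unnormalised, on functions of an integer variable: shifts and negative frequencies are then
    plain integer arithmetic, and periodicity is a separate hypothesis. *)
Definition fourier f k : R[i] := \sum_(l < L) f l%:Z * character (- (l%:Z * k)).

(** The pointwise lag product; summing it over [l] gives the usual autocorrelation at lag [s]. *)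
Definition correlation f s l : R[i] := f (l + s) * (f l)^*.

Let L_neq0 : (L%:R : R) != 0. Proof. by rewrite pnatr_eq0 -lt0n. Qed.

Let L_neq0C : (L%:R : R[i]) != 0. Proof. by rewrite pnatr_eq0 -lt0n. Qed.

Lemma characterD z s : character (z + s) = character z * character s.
Proof. by rewrite /character rmorphD /= mulrDr mulrDl cisD. Qed.

Lemma characterN z : character (- z) = (character z)^*.
Proof. by rewrite /character rmorphN /= mulrN mulNr cisN. Qed.

Lemma characterJ z : (character z)^* = character (- z).
Proof. by rewrite characterN. Qed.

Lemma character0 : character 0 = 1.
Proof. by rewrite /character rmorph0 mulr0 mul0r cis0. Qed.

Lemma cabs_character z : cabs (character z) = 1.
Proof. exact: cabs_cis. Qed.

Lemma character_dvd z : (L%:Z %| z)%Z -> character z = 1.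
Proof.
case/dvdzP=> q ->; rewrite /character rmorphM /= -pmulrn mulrA mulfK //.
exact: cis2pi_int.
Qed.

Lemma character_congr z s : (z = s %[mod L%:Z])%Z -> character z = character s.
Proof.
move/eqP; rewrite eqz_mod_dvd => /character_dvd h.
by rewrite -[z](subrK s) characterD h mul1r.
Qed.

Lemma character_neq1 z : ~~ (L%:Z %| z)%Z -> character z != 1.
Proof.
move=> ndvd; have Lz : L%:Z != 0 by rewrite -lt0n.
rewrite (@character_congr z (z %% L%:Z)%Z) ?modz_mod //.
have m_ge0 := modz_ge0 z Lz; have := ltz_pmod z (_ : 0 < L%:Z).
rewrite ltz_nat => /(_ L_gt0) m_lt.
have {m_ge0}m_gt0 : 0 < (z %% L%:Z)%Z.
  rewrite lt_neqAle m_ge0 andbT eq_sym.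
  by apply: contra ndvd => /eqP /dvdz_mod0P.
have L0 : 0 < (L%:R : R) by rewrite ltr0n.
have pi0 : 0 < (pi : R) := pi_gt0 R.
apply: cis_neq1; apply/andP; split.
  by rewrite !mulr_gt0 ?invr_gt0 // ltr0z.
by rewrite ltr_pdivrMr // ltr_pM2l ?mulr_gt0 // -[L%:R]/((L%:Z)%:~R) ltr_int.
Qed.

Lemma periodic_congr f z s :
  modperiodic f -> (z = s %[mod L%:Z])%Z -> f z = f s.
Proof.
move=> per /eqP; rewrite eqz_mod_dvd => /dvdzP[q e].
have -> : z = s + q * L%:Z by rewrite -e; ring.
elim/int_ind: q {e z} => [|n IHn|n IHn]; first by rewrite mul0r addr0.
  by rewrite -addn1 PoszD mulrDl mul1r addrA per.
rewrite -IHn -[LHS]per; congr f.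
by rewrite -addn1 PoszD; ring.
Qed.

Lemma periodic_character k : modperiodic (fun z => character (z * k)).
Proof.
move=> z; apply: character_congr; apply/eqP; rewrite eqz_mod_dvd.
by apply/dvdzP; exists k; ring.
Qed.

Lemma sum_periodic_shift f s : modperiodic f ->
  \sum_(l < L) f (l%:Z + s) = \sum_(l < L) f l%:Z.
Proof.
move=> per; have step (t : int) :
    \sum_(l < L) f (l%:Z + (t + 1)) = \sum_(l < L) f (l%:Z + t).
  have [n Ln] : exists n, L = n.+1 by exists L.-1; rewrite prednK.
  rewrite Ln big_ord_recr [RHS]big_ord_recl /= addrC; congr (_ + _).
    rewrite add0r (_ : n%:Z + _ = t + L%:Z) ?per //.
    by rewrite Ln intS; ring.
  by apply: eq_bigr => i _; congr f; rewrite /bump /= add1n -addn1 PoszD; ring.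
elim/int_ind: s => [|n IHn|n IHn].
- by apply: eq_bigr => i _; rewrite addr0.
- by rewrite -addn1 PoszD step.
- by rewrite -IHn -[LHS]step -addn1 PoszD; apply: eq_bigr => i _; congr f; ring.
Qed.

Lemma sum_periodic_reflect f s : modperiodic f ->
  \sum_(l < L) f (s - l%:Z) = \sum_(l < L) f l%:Z.
Proof.
(* The reversal sends [l] to [L - 1 - l], and shifting that by [s + 1 - L] gives [s - l]. *)
move=> per; rewrite -(sum_periodic_shift (s + 1 - L%:Z) per).
rewrite (reindex_inj rev_ord_inj) /=; apply: eq_bigr => i _.
by congr f; rewrite -subzn ?ltn_ord // -addn1 PoszD; ring.
Qed.

(** Multiplying the sum by [character z] shifts its summands cyclically. Hence [character z - 1]
    annihilates the sum, and it is nonzero unless [L] divides [z]. *)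
Lemma sum_character z :
  \sum_(n < L) character (n%:Z * z) = if (L%:Z %| z)%Z then L%:R else 0.
Proof.
case: ifPn => [dvd|/character_neq1 neq1].
  rewrite (eq_bigr (fun=> 1)) => [|n _]; first by rewrite sumr_const card_ord.
  by apply: character_dvd; rewrite dvdz_mull.
apply/eqP; have : (character z - 1) * \sum_(n < L) character (n%:Z * z) == 0.
  rewrite mulrBl mul1r -{2}(sum_periodic_shift 1 (periodic_character z)).
  rewrite mulr_sumr subr_eq0; apply/eqP/eq_bigr => n _.
  by rewrite mulrDl mul1r characterD mulrC.
by rewrite mulf_eq0 subr_eq0 (negbTE neq1).
Qed.

Lemma fourier_inversion f s : modperiodic f ->
  \sum_(k < L) fourier f k%:Z * character (k%:Z * s) = L%:R * f s.
Proof.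
move=> per; under eq_bigr do rewrite mulr_suml.
rewrite exchange_big /=.
rewrite (eq_bigr (fun l : 'I_L => f l%:Z *
           \sum_(k < L) character (k%:Z * (s - l%:Z)))); last first.
  move=> l _; rewrite mulr_sumr; apply: eq_bigr => k _.
  by rewrite -mulrA -characterD; congr (_ * character _); ring.
under eq_bigr do rewrite sum_character.
have Lz : L%:Z != 0 by rewrite -lt0n.
have s_lt : (absz (s %% L%:Z)%Z < L)%N.
  by rewrite -ltz_nat gez0_abs ?modz_ge0 // ltz_pmod // ltz_nat.
have s_mod : (Ordinal s_lt : nat)%:Z = (s %% L%:Z)%Z.
  by rewrite /= gez0_abs ?modz_ge0.
(* By orthogonality only the index congruent to [s] survives. *)
rewrite (bigD1 (Ordinal s_lt)) //= big1 => [|l ne]; last first.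
  rewrite ifN ?mulr0 //; apply: contra ne; rewrite -eqz_mod_dvd => /eqP e.
  apply/eqP/val_inj/eqP; rewrite -eqz_nat s_mod e.
  by rewrite modz_small ?ltz_nat ?ltn_ord.
rewrite addr0 s_mod -eqz_mod_dvd modz_mod eqxx mulrC; congr (_ * _).
by apply: periodic_congr => //; rewrite modz_mod.
Qed.

Lemma fourierJ f k :
  (fourier f k)^* = \sum_(l < L) (f l%:Z)^* * character (l%:Z * k).
Proof.
rewrite /fourier rmorph_sum; apply: eq_bigr => l _.
by rewrite rmorphM /= characterJ opprK.
Qed.

(** Wiener-Khinchin: once the conjugate transform is expanded, the sum over [n] is the inversion
    formula for [f] at [l + s]. Lag 0 gives Parseval. *)
Lemma fourier_autocorrelation f s : modperiodic f ->
  \sum_(n < L) fourier f n%:Z * (fourier f n%:Z)^* * character (n%:Z * s) =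
  L%:R * \sum_(l < L) correlation f s l%:Z.
Proof.
move=> per.
under eq_bigr => n _ do rewrite fourierJ mulr_sumr mulr_suml.
rewrite exchange_big mulr_sumr; apply: eq_bigr => l _ /=.
rewrite /correlation mulrA -fourier_inversion // mulr_suml.
apply: eq_bigr => n _; rewrite mulrDr characterD [l%:Z * _]mulrC.
by ring.
Qed.

Lemma parseval f : modperiodic f ->
  \sum_(k < L) cabs (fourier f k%:Z) ^+ 2 =
  L%:R * \sum_(l < L) cabs (f l%:Z) ^+ 2.
Proof.
move=> per; apply: complexI.
rewrite rmorphM rmorph_nat !rmorph_sum /=.
under eq_bigr do rewrite cabs_sqr.
under [in RHS]eq_bigr do rewrite cabs_sqr.
transitivity (L%:R * \sum_(l < L) correlation f 0 l%:Z); last first.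
  by congr (_ * _); apply: eq_bigr => l _; rewrite /correlation addr0.
rewrite -fourier_autocorrelation //.
by apply: eq_bigr => n _; rewrite mulr0 character0 mulr1.
Qed.

Lemma periodic_correlation f s : modperiodic f -> modperiodic (correlation f s).
Proof. by move=> per z; rewrite /correlation per addrAC per. Qed.

(** Inversion expands both factors of the lag product; a pair of frequencies [j], [j'] contributes
    only at [k] congruent to [j - j']. A difference of two representatives in [[-B, B]] lies in
    [[-2B, 2B]]. *)
Lemma fourier_correlation_band f s (B : nat) k : modperiodic f ->
    (forall j : 'I_L, fourier f j%:Z != 0 ->
       exists2 n : int, - B%:Z <= n <= B%:Z & (j%:Z = n %[mod L%:Z])%Z) ->
    fourier (correlation f s) k != 0 ->
  exists2 n : int, - (2 * B)%:Z <= n <= (2 * B)%:Z & (k = n %[mod L%:Z])%Z.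
Proof.
move=> per band; apply: contraNP => noband.
(* One factor [L] for each of the two uses of inversion. *)
rewrite -(mulrI_eq0 _ (mulfI L_neq0C)) -(mulrI_eq0 _ (mulfI L_neq0C)).
rewrite /fourier !mulr_sumr; apply/eqP.
rewrite (eq_bigr (fun l : 'I_L => \sum_(j < L) \sum_(j' < L)
    fourier f j%:Z * (fourier f j'%:Z)^* * character (j%:Z * s) *
    character (l%:Z * (j%:Z - j'%:Z - k)))); last first.
  move=> l _; rewrite /correlation.
  transitivity ((L%:R * f (l%:Z + s)) * (L%:R * f l%:Z)^* *
                character (- (l%:Z * k))).
    by rewrite rmorphM /= conjC_nat; ring.
  rewrite -!fourier_inversion // rmorph_sum !mulr_suml.
  apply: eq_bigr => j _; rewrite mulr_sumr mulr_suml; apply: eq_bigr => j' _.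
  rewrite rmorphM /= characterJ mulrDr !mulrBr !characterD.
  by rewrite [l%:Z * j'%:Z]mulrC [l%:Z * j%:Z]mulrC; ring.
rewrite exchange_big big1 // => j _; rewrite exchange_big big1 // => j' _ /=.
rewrite -mulr_sumr sum_character; case: ifPn => [dvd|]; last by rewrite mulr0.
have [->|/band[a ha ja]] := eqVneq (fourier f j%:Z) 0; first by rewrite !mul0r.
have [->|/band[b hb jb]] := eqVneq (fourier f j'%:Z) 0.
  by rewrite conjC0 mulr0 !mul0r.
case: noband; exists (a - b); first by lia.
apply/eqP; rewrite eqz_mod_dvd.
move/eqP: ja; rewrite eqz_mod_dvd => /dvdzP[p ep].
move/eqP: jb; rewrite eqz_mod_dvd => /dvdzP[q eq].
case/dvdzP: dvd => r er; apply/dvdzP; exists (p - q - r).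
by rewrite !mulrBl -ep -eq -er; ring.
Qed.

(** The Gabor transform with window [g], without the factor [1 / sqrt L] and at arbitrary integers
    [m], [n]. *)
Definition stft g f m n : R[i] := fourier (fun l => f l * (g (l - m))^*) n.

Lemma periodic_stft_product g f m : modperiodic g -> modperiodic f ->
  modperiodic (fun l => f l * (g (l - m))^*).
Proof. by move=> gper fper z; rewrite fper addrAC gper. Qed.

(** Substituting [l + s] for [l] turns the windowed product into the lag product. The extra
    character has modulus one, so it disappears from absolute values of the ambiguity function. *)
Lemma stft_self g s k : modperiodic g ->
  stft g g s k = character (- (s * k)) * fourier (correlation g s) k.
Proof.
move=> per; rewrite /stft /fourier -(@sum_periodic_shift
  (fun l => g l * (g (l - s))^* * character (- (l * k))) s); last first.
  move=> z; rewrite per addrAC per; congr (_ * _).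
  by rewrite -!mulNr opprD; apply: character_congr; apply/eqP;
     rewrite eqz_mod_dvd; apply/dvdzP; exists (- k); ring.
rewrite mulr_sumr; apply: eq_bigr => l _.
by rewrite /correlation addrK mulrDl opprD characterD; ring.
Qed.

Lemma stft_congr g f m m' n n' : modperiodic g ->
    (m = m' %[mod L%:Z])%Z -> (n = n' %[mod L%:Z])%Z ->
  stft g f m n = stft g f m' n'.
Proof.
move=> per /eqP; rewrite eqz_mod_dvd => /dvdzP[p ep].
move=> /eqP; rewrite eqz_mod_dvd => /dvdzP[q eq].
apply: eq_bigr => l _; congr (_ * _^* * _).
  apply: periodic_congr => //; apply/eqP; rewrite eqz_mod_dvd.
  by apply/dvdzP; exists (- p); rewrite mulNr -ep; ring.
apply: character_congr; apply/eqP; rewrite eqz_mod_dvd.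
by apply/dvdzP; exists (- (l%:Z * q)); rewrite mulNr -mulrA -eq; ring.
Qed.

(** The sum over [n] is an autocorrelation at lag [s] of [f] times the conjugate shifted window,
    whose lag product factors into those of [f] and [g]. What is left in [m] is a convolution, and
    its Fourier transform is a product. *)
Lemma fourier_spectrogram g f s k : modperiodic g -> modperiodic f ->
  \sum_(m < L) (\sum_(n < L) stft g f m%:Z n%:Z * (stft g f m%:Z n%:Z)^* *
     character (n%:Z * s)) * character (- (m%:Z * k)) =
  L%:R * (fourier (correlation f s) k * (fourier (correlation g s) k)^*).
Proof.
move=> gper fper.
under eq_bigr => m _.
  rewrite fourier_autocorrelation; last exact: periodic_stft_product.
  rewrite -mulrA mulr_suml.
  over.
rewrite -mulr_sumr; congr (_ * _); rewrite exchange_big mulr_suml.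
apply: eq_bigr => l _ /=.
(* The character at [- (m * k)] splits as [- (l * k)] plus [(l - m) * k], which separates the two
   factors of the convolution. *)
transitivity (correlation f s l%:Z * character (- (l%:Z * k)) *
  \sum_(m < L) (correlation g s (l%:Z - m%:Z))^* *
               character ((l%:Z - m%:Z) * k)).
  rewrite mulr_sumr; apply: eq_bigr => m _; rewrite /correlation.
  rewrite mulrBl characterD !rmorphM /= !conjCK addrAC.
  rewrite -!mulrA; congr (_ * _).
  rewrite [character (- (l%:Z * k))]characterN.
  have : character (l%:Z * k) * (character (l%:Z * k))^* = 1.
    by rewrite -characterN -characterD subrr character0.
  by move: (character _) => u hu; ring: hu.
congr (_ * _); rewrite fourierJ.
rewrite (@sum_periodic_reflect
  (fun z => (correlation g s z)^* * character (z * k))) //.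
by move=> z; rewrite periodic_correlation // periodic_character.
Qed.

End PeriodicFourier.

Arguments character {R} L z.

(** * From the measurements to the lag products of the signals *)

Section PhaselessMeasurements.
Variables (R : realType) (L : nat).
Hypothesis L_gt0 : (0 < L)%N.
Local Open Scope complex_scope.
Local Open Scope ring_scope.
Implicit Types (x y phi : 'cV[R[i]]_L) (s k : int).

Let Lz_neq0 : L%:Z != 0. Proof. by rewrite -lt0n. Qed.

Let mod_lt (z : int) : (absz (z %% L%:Z)%Z < L)%N.
Proof. by rewrite -ltz_nat gez0_abs ?modz_ge0 // ltz_pmod // ltz_nat. Qed.

Let residue (z : int) : 'I_L := Ordinal (mod_lt z).

Let residueE z : (residue z : nat)%:Z = (z %% L%:Z)%Z.
Proof. by rewrite /= gez0_abs ?modz_ge0. Qed.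

Let insub_residue z : insub `|(z %% L%:Z)%Z|%N = Some (residue z).
Proof. by rewrite (insubT (fun n => n < L)%N (mod_lt z)). Qed.

Lemma vec_at_ord x (l : 'I_L) : vec_at x l%:Z = x l 0.
Proof.
rewrite /vec_at modz_small ?absz_nat; first by rewrite valK.
by rewrite /= ltz_nat.
Qed.

Lemma vec_at_periodic x : modperiodic L (vec_at x).
Proof. by move=> z; rewrite /vec_at modzDr. Qed.

Let sqrtL_neq0 : (Num.sqrt L%:R : R) != 0.
Proof. by rewrite sqrtr_eq0 -ltNge ltr0n. Qed.

Lemma dftE x (k : 'I_L) :
  dft x k 0 = ((Num.sqrt L%:R : R)^-1)%:C * fourier L (vec_at x) k%:Z.
Proof.
rewrite mxE; congr (_ * _); apply: eq_bigr => l _.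
rewrite vec_at_ord /character; congr (_ * cis _).
by rewrite rmorphN rmorphM /= -!pmulrn mulrN mulNr !mulrA.
Qed.

Lemma gaborE phi x (m n : 'I_L) : gabor phi x m n =
  ((Num.sqrt L%:R : R)^-1)%:C * stft L (vec_at phi) (vec_at x) m%:Z n%:Z.
Proof.
rewrite mxE; congr (_ * _); apply: eq_bigr => l _.
rewrite vec_at_ord /character; congr (_ * cis _).
by rewrite rmorphN rmorphM /= -!pmulrn mulrN mulNr !mulrA.
Qed.

Lemma mx_at_ambiguity phi s k : mx_at (ambiguity phi) s k =
  ((Num.sqrt L%:R : R)^-1)%:C * stft L (vec_at phi) (vec_at phi) s k.
Proof.
rewrite /mx_at /vec_at !insub_residue 2!mxE.
rewrite [LHS](gaborE phi phi (residue s) (residue k)); congr (_ * _).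
by apply: (stft_congr L_gt0); [exact: vec_at_periodic | |];
   rewrite residueE modz_mod.
Qed.

Lemma cabs_mx_at_ambiguity phi s k : cabs (mx_at (ambiguity phi) s k) =
  (Num.sqrt L%:R)^-1 * cabs (fourier L (correlation (vec_at phi) s) k).
Proof.
rewrite mx_at_ambiguity stft_self //; last exact: vec_at_periodic.
by rewrite !cabsM cabs_character mul1r cabs_real ger0_norm.
Qed.

Lemma mx_at_congr phi s k k' : (k = k' %[mod L%:Z])%Z ->
  mx_at (ambiguity phi) s k = mx_at (ambiguity phi) s k'.
Proof. by move=> kk'; rewrite /mx_at /vec_at kk'. Qed.

Lemma bandlimited_fourier (B : nat) x : bandlimited B x ->
  forall j : 'I_L, fourier L (vec_at x) j%:Z != 0 ->
  exists2 n : int, - B%:Z <= n <= B%:Z & (j%:Z = n %[mod L%:Z])%Z.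
Proof.
move=> band j nz; apply: band; rewrite inE dftE mulf_neq0 //.
by rewrite fmorph_eq0 invr_eq0.
Qed.

Lemma measurementsE phi x (m n : 'I_L) : (measurements phi x m n)%:C =
  L%:R^-1 * (stft L (vec_at phi) (vec_at x) m%:Z n%:Z *
             (stft L (vec_at phi) (vec_at x) m%:Z n%:Z)^*).
Proof.
rewrite mxE gaborE cabsM exprMn cabs_real ger0_norm // exprVn.
rewrite sqr_sqrtr ?ler0n //.
by rewrite rmorphM /= cabs_sqr fmorphV rmorph_nat.
Qed.

(** With [D] the difference of the lag products and [g] the transform in [n] of the measurement
    difference, the Fourier transform of [g] is that of [D] times a conjugate window factor. This
    factor has modulus at least [sqrt L / c] on the band that carries [D], so Parseval for [D] and
    [g] bounds the sum for [D] by [c ^+ 2 / L] times that for [g]. *)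
Lemma sum_correlation_diff_le (B : nat) x y phi (c : R) s :
    bandlimited B x -> bandlimited B y -> 0 < c ->
    (forall n : int, - (2 * B)%:Z <= n <= (2 * B)%:Z ->
       1 / c <= cabs (mx_at (ambiguity phi) s n)) ->
  \sum_(l < L) cabs (correlation (vec_at x) s l%:Z -
                     correlation (vec_at y) s l%:Z) ^+ 2 <=
  (c * frobenius (measurements phi x - measurements phi y)) ^+ 2.
Proof.
move=> bx byy c0 hphi.
set fx := vec_at x; set fy := vec_at y; set fp := vec_at phi.
have px : modperiodic L fx := vec_at_periodic x.
have py : modperiodic L fy := vec_at_periodic y.
have pp : modperiodic L fp := vec_at_periodic phi.
have L0 : 0 < (L%:R : R) by rewrite ltr0n.
have L0C : (L%:R : R[i]) != 0 by rewrite pnatr_eq0 -lt0n.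
pose D l := correlation fx s l - correlation fy s l.
pose E f m n := stft L fp f m n * (stft L fp f m n)^* : R[i].
(* [E] is [L] times the measurement; the factor [L^-1] compensates. *)
pose g m : R[i] :=
  L%:R^-1 * \sum_(n < L) (E fx m n%:Z - E fy m n%:Z) * character L (n%:Z * s).
have pD : modperiodic L D.
  by move=> z; rewrite /D (periodic_correlation _ px)
    (periodic_correlation _ py).
have pg : modperiodic L g.
  move=> z; congr (_ * _); apply: eq_bigr => n _; congr ((_ - _) * _);
  by rewrite /E (@stft_congr _ _ L_gt0 _ _ (z + L%:Z) z n%:Z n%:Z) // modzDr.
have fD k : fourier L D k =
    fourier L (correlation fx s) k - fourier L (correlation fy s) k.
  by rewrite /fourier -sumrB; apply: eq_bigr => l _; rewrite mulrBl.
have fg k : fourier L g k =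
    fourier L D k * (fourier L (correlation fp s) k)^*.
  apply: (mulfI L0C); rewrite fD mulrBl mulrBr -!fourier_spectrogram //.
  rewrite /fourier mulr_sumr -sumrB; apply: eq_bigr => m _.
  rewrite /g !mulrA divff // mul1r -mulrBl -sumrB; congr (_ * _).
  by apply: eq_bigr => n _; rewrite mulrBl.
have bound (k : 'I_L) : cabs (fourier L D k%:Z) ^+ 2 <=
    c ^+ 2 / L%:R * cabs (fourier L g k%:Z) ^+ 2.
  have [->|nz] := eqVneq (fourier L D k%:Z) 0.
    rewrite cabs0 expr0n /= mulr_ge0 ?sqr_ge0 //.
    by rewrite divr_ge0 ?sqr_ge0 ?ler0n.
  have [n n_band kn] : exists2 n : int,
      - (2 * B)%:Z <= n <= (2 * B)%:Z & (k%:Z = n %[mod L%:Z])%Z.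
    (* If the transform of [D] is nonzero at [k], then so is that of the lag product of [x] or of
       [y], and either one confines [k] to the band. *)
    have [x0|x_nz] := eqVneq (fourier L (correlation fx s) k%:Z) 0.
      apply: (fourier_correlation_band (s := s) L_gt0 py
                (bandlimited_fourier byy)).
      by move: nz; rewrite fD x0 sub0r oppr_eq0.
    exact: (fourier_correlation_band L_gt0 px (bandlimited_fourier bx) x_nz).
  have := hphi n n_band; rewrite -(mx_at_congr _ _ kn) cabs_mx_at_ambiguity.
  rewrite fg cabsM cabsJ; set p := cabs (fourier L _ k%:Z) => hp.
  set d := cabs (fourier L D k%:Z).
  have d0 : 0 <= d := cabs_ge0 _.
  have ineq : 1 <= c ^+ 2 / L%:R * p ^+ 2.
    have : 1 ^+ 2 <= (c * ((Num.sqrt L%:R)^-1 * p)) ^+ 2.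
      have h1 : 1 <= c * ((Num.sqrt L%:R)^-1 * p).
        by rewrite -ler_pdivrMl // mulrC.
      by rewrite lerXn2r // nnegrE ?ler01 // (le_trans _ h1).
    by rewrite expr1n !exprMn exprVn sqr_sqrtr ?ler0n // mulrA.
  have -> : c ^+ 2 / L%:R * (d * p) ^+ 2 = (c ^+ 2 / L%:R * p ^+ 2) * d ^+ 2.
    by rewrite exprMn; ring.
  by rewrite ler_peMl ?sqr_ge0.
have sum_g : \sum_(m < L) cabs (g m%:Z) ^+ 2 <=
    L%:R * frobenius (measurements phi x - measurements phi y) ^+ 2.
  rewrite sqr_sqrtr; last first.
    by apply: sumr_ge0 => m _; apply: sumr_ge0 => n _; exact: sqr_ge0.
  rewrite mulr_sumr; apply: ler_sum => m _.
  have -> : g m%:Z = \sum_(n < L)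
     ((measurements phi x - measurements phi y) m n)%:C *
      character L (n%:Z * s).
    rewrite /g mulr_sumr; apply: eq_bigr => n _.
    rewrite [(measurements phi x - _) m n]mxE [(- measurements phi y) m n]mxE.
    by rewrite rmorphB /= !measurementsE -mulrBr mulrA.
  (* The triangle inequality drops the characters; Cauchy-Schwarz over the [L] entries of a row then
     costs the factor [L], which cancels the one in [bound]. *)
  apply: (@le_trans _ _ ((\sum_(n < L)
      `|(measurements phi x - measurements phi y) m n|) ^+ 2)).
    rewrite lerXn2r ?nnegrE ?cabs_ge0 //; first by apply: sumr_ge0.
    apply: le_trans (cabs_sum_le _ _ _) _; apply: ler_sum => n _.
    by rewrite cabsM cabs_character mulr1 cabs_real.
  apply: le_trans (sqr_sum_le_sum_sqr _ _ _) _.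
  by rewrite sumr_const card_ord.
rewrite -(ler_pM2l L0) -(parseval L_gt0 pD).
apply: (@le_trans _ _ (\sum_(k < L)
    c ^+ 2 / L%:R * cabs (fourier L g k%:Z) ^+ 2)); first exact: ler_sum.
rewrite -mulr_sumr (parseval L_gt0 pg) exprMn.
rewrite [leLHS]mulrA divfK ?gt_eqF // mulrCA.
by rewrite ler_wpM2l ?sqr_ge0.
Qed.

End PhaselessMeasurements.

(** * Connected vertex sets of the cycle are arcs *)

Section CyclicArcs.
Variable L : nat.
Implicit Types (S : {set 'I_L}) (e : rel 'I_L).

(* A longest injective run of successors inside [S] cannot be prolonged at
   either end, so no edge of [S] leaves it. *)
Lemma cyclic_connected_arc e S :
    (forall u v, e u v -> v = ordS u \/ u = ordS v) ->
    induced_connected e S -> S != finset.set0 ->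
  exists a, uniq (traject (@ordS L) a #|S|) /\ traject (@ordS L) a #|S| =i S.
Proof.
move=> e_succ conn /set0Pn[v0 v0S].
pose P q := [exists a, uniq (traject (@ordS L) a q) &&
                       all [in S] (traject (@ordS L) a q)].
have P_bound q : P q -> (q <= L)%N.
  case/existsP=> a /andP[/card_uniqP]; rewrite size_traject => <- _.
  by rewrite -[leqRHS]card_ord max_card.
have exP : exists q, P q by exists 1; apply/existsP; exists v0; rewrite /= v0S.
have P1 : P 1 by apply/existsP; exists v0; rewrite /= v0S.
case: (ex_maxnP exP P_bound) => q /existsP[a /andP[uniq_s /allP sS]] q_max.
have q_gt0 : (0 < q)%N := q_max 1 P1.
set s := traject _ a q in uniq_s sS.
have as_ : a \in s by apply/trajectP; exists 0.
have not_longer b : ~~ (uniq (traject (@ordS L) b q.+1) &&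
                        all [in S] (traject (@ordS L) b q.+1)).
  apply/negP => h; have : (q.+1 <= q)%N.
    by apply: q_max; apply/existsP; exists b.
  by rewrite ltnn.
(* Only the last point of the run is at issue: a successor in [S] but outside the run would prolong
   it. For [pred_closed] the first point plays this part. *)
have succ_closed u : u \in s -> ordS u \in S -> ordS u \in s.
  case/trajectP=> i iq ->; rewrite -iterS => h.
  have [iSq|] := ltnP i.+1 q; first by apply/trajectP; exists i.+1.
  rewrite leq_eqVlt ltnS leqNgt iq orbF => /eqP iSq.
  move: (not_longer a); rewrite trajectSr -/s rcons_uniq all_rcons uniq_s andbT.
  by rewrite iSq h (introT allP sS) !andbT negbK.
have pred_closed u : ordS u \in s -> u \in S -> u \in s.
  case/trajectP=> -[_ ua|i iq e1 _]; last first.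
    by apply/trajectP; exists i; [exact: ltnW | apply: (can_inj (@ordSK L))].
  move=> uS; move: (not_longer u); rewrite trajectS ua -/s /= uS uniq_s.
  by rewrite (introT allP sS) !andbT negbK.
have s_closed u v : u \in s -> Defs.induced e S u v -> v \in s.
  move=> us /and3P[_ vS /e_succ[vu|uv]].
    by rewrite vu in vS *; exact: succ_closed.
  by apply: pred_closed => //; rewrite -uv.
have sE : s =i S.
  move=> u; apply/idP/idP => [/sS//|uS].
  have /connectP[p + ->] := conn a u (sS _ as_) uS.
  elim: p (a) as_ => //= v p IHp b bs /andP[/(s_closed _ _ bs)]; exact: IHp.
have cardS : #|S| = q.
  by rewrite -(eq_card sE) (card_uniqP uniq_s) size_traject.
by exists a; rewrite cardS.
Qed.

Lemma ess_edge_ordS (R : realType) (delta : R) (x : 'cV[R[i]]_L) (u v : 'I_L) :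
  ess_edge delta x u v -> v = ordS u \/ u = ordS v.
Proof.
have uL := ltn_ord u; have vL := ltn_ord v.
case/and3P=> _ _ h.
(* An integer distance is 1 in the first range and [L - 1], the wrap-around, in the second. For
   [L = 1] the latter is a loop at 0, where [ordS] fixes the point. *)
have cases : (v = u.+1 :> nat) \/ (u = v.+1 :> nat) \/
   ((u.+1 = L /\ v = 0 :> nat) \/ (v.+1 = L /\ u = 0 :> nat)) by lia.
case: cases => [vu|[uv|[[uL1 v0]|[vL1 u0]]]];
  [left|right|left|right]; apply: val_inj => /=.
- by rewrite -vu modn_small.
- by rewrite -uv modn_small.
- by rewrite uL1 modnn.
- by rewrite vL1 modnn.
Qed.

End CyclicArcs.

(** * Relative phases and their variation along a path *)

Section PhaseSynchronisation.
Variable R : realType.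
Local Open Scope complex_scope.
Local Open Scope ring_scope.
Implicit Types (z w : R[i]).

Lemma directionM z w : direction (z * w) = direction z * direction w.
Proof. by rewrite /direction cabsM rmorphM invfM mulrACA. Qed.

Lemma directionJ z : direction z^* = (direction z)^*.
Proof.
rewrite /direction cabsJ rmorphM fmorphV; congr (_ / _).
by rewrite cabsE /= conj_normC.
Qed.

Lemma unit_mulJ z : cabs z = 1 -> z * z^* = 1.
Proof. by move=> z1; rewrite -cabs_sqr z1 expr1n. Qed.

Definition relative_phase z w := direction z * (direction w)^*.

Lemma cabs_relative_phase z w : z != 0 -> w != 0 ->
  cabs (relative_phase z w) = 1.
Proof. by move=> z0 w0; rewrite cabsM cabsJ !cabs_direction // mulr1. Qed.

Lemma relative_phase_dist (delta : R) z w z' w' : 0 < delta ->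
    delta <= cabs z -> delta <= cabs z' -> w != 0 -> w' != 0 ->
  cabs (relative_phase z' w' - relative_phase z w) <=
  2 / delta ^+ 2 * cabs (z' * z^* - w' * w^*).
Proof.
move=> d0 dz dz' w0 w'0.
have nz0 v : delta <= cabs v -> v != 0.
  by move=> dv; rewrite -cabs_eq0 gt_eqF // (lt_le_trans d0).
have z0 := nz0 _ dz; have z'0 := nz0 _ dz'.
have -> : cabs (relative_phase z' w' - relative_phase z w) =
    cabs (direction (z' * z^*) - direction (w' * w^*)).
  transitivity (cabs ((relative_phase z' w' - relative_phase z w) *
                      (direction w' * (direction z)^*))).
    by rewrite [RHS]cabsM [cabs (_ * _^*)]cabsM cabsJ !cabs_direction // !mulr1.
  rewrite !directionM !directionJ /relative_phase; congr cabs.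
  have h1 := unit_mulJ (cabs_direction w'0).
  have h2 := unit_mulJ (cabs_direction z0).
  transitivity (direction z' * (direction z)^* *
                (direction w' * (direction w')^*) -
    direction w' * (direction w)^* * (direction z * (direction z)^*)).
    by ring.
  by rewrite h1 h2 !mulr1.
have zz0 : z' * z^* != 0 by rewrite mulf_neq0 // conjC_eq0.
have ww0 : w' * w^* != 0 by rewrite mulf_neq0 // conjC_eq0.
have := direction_dist zz0 ww0.
move: (cabs_ge0 (direction (z' * z^*) - direction (w' * w^*))).
move: (cabs (_ - _)) (cabs (_ - _)) => t D t0 h.
rewrite mulrAC ler_pdivlMr ?exprn_gt0 // mulrC; apply: le_trans h.
rewrite ler_wpM2r // cabsM cabsJ expr2.
by apply: ler_pM => //; exact: ltW.
Qed.

(** Dividing by the direction of [w] leaves a radial error, rotated by [v], and an angular error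
    scaled by [cabs z]. *)
Lemma dist_phase_le z w v : w != 0 -> cabs v = 1 ->
  cabs (z - v * w) <=
  `|cabs z - cabs w| + cabs z * cabs (relative_phase z w - v).
Proof.
move=> w0 v1; have h := unit_mulJ (cabs_direction w0).
have -> : z - v * w = direction w *
    (v * (cabs z - cabs w)%:C + (cabs z)%:C * (relative_phase z w - v)).
  rewrite {1}(directionE z) {1}(directionE w) /relative_phase rmorphB /=.
  transitivity ((cabs z)%:C * direction z * (direction w * (direction w)^*) -
                v * ((cabs w)%:C * direction w)); first by rewrite h mulr1.
  by ring.
rewrite cabsM cabs_direction // mul1r; apply: le_trans (cabsD _ _) _.
by rewrite !cabsM v1 mul1r !cabs_real (ger0_norm (cabs_ge0 z)).
Qed.

Lemma sqr_cabs_telescope (u : nat -> R[i]) (m n : nat) : (m <= n)%N ->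
  cabs (u n - u m) ^+ 2 <=
  (n - m)%:R * \sum_(m <= t < n) cabs (u t.+1 - u t) ^+ 2.
Proof.
move=> mn; rewrite -telescope_sumr //.
apply: (@le_trans _ _ ((\sum_(m <= t < n) cabs (u t.+1 - u t)) ^+ 2)).
  rewrite lerXn2r ?nnegrE ?cabs_ge0 ?cabs_sum_le //.
  by apply: sumr_ge0 => t _; exact: cabs_ge0.
by apply: le_trans (sqr_sum_le_sum_sqr _ _ _) _; rewrite sumr_const_nat.
Qed.

(* Measured from the middle of the run, every telescope has length at most
   q/2. *)
Lemma sqr_cabs_center_dist (u : nat -> R[i]) (E : nat -> R) (q i : nat) :
    (i < q)%N -> (forall t, (t.+1 < q)%N -> cabs (u t.+1 - u t) <= E t) ->
  cabs (u i - u q./2) ^+ 2 <= q%:R / 2 * \sum_(t < q) E t ^+ 2.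
Proof.
move=> iq uE.
have half m n : (m <= n)%N -> (n < q)%N -> (2 * (n - m) <= q)%N ->
    cabs (u n - u m) ^+ 2 <= q%:R / 2 * \sum_(t < q) E t ^+ 2.
  move=> mn nq len; apply: le_trans (sqr_cabs_telescope u mn) _.
  apply: ler_pM; rewrite ?ler0n //.
  - by apply: sumr_ge0 => t _; exact: sqr_ge0.
  - by rewrite ler_pdivlMr // -natrM ler_nat mulnC.
  apply: (@le_trans _ _ (\sum_(m <= t < n) E t ^+ 2)).
    rewrite !big_nat; apply: ler_sum => t /andP[mt tn].
    have h : cabs (u t.+1 - u t) <= E t.
      by apply: uE; exact: leq_ltn_trans tn nq.
    by rewrite lerXn2r ?nnegrE ?cabs_ge0 // (le_trans _ h) // cabs_ge0.
  rewrite -(big_mkord xpredT (fun t => E t ^+ 2)).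
  rewrite (big_cat_nat (leq0n m) (leq_trans mn (ltnW nq))) /=.
  rewrite (big_cat_nat mn (ltnW nq)) /=.
  rewrite addrCA lerDl addr_ge0 // sumr_ge0 // => t _; exact: sqr_ge0.
have [le|/ltnW le] := leqP q./2 i; first by apply: half => //; lia.
by rewrite -cabsN opprB; apply: half => //; lia.
Qed.

End PhaseSynchronisation.

(** * A single global phase on the support, and the resulting pointwise error *)

Section Synchronisation.
Variables (R : realType) (L : nat).
Hypothesis L_gt0 : (0 < L)%N.
Local Open Scope complex_scope.
Local Open Scope ring_scope.
Implicit Types x y : 'cV[R[i]]_L.

Lemma correlation0_diff x y (l : 'I_L) :
  cabs (correlation (vec_at x) 0 l%:Z - correlation (vec_at y) 0 l%:Z) =
  `|cabs (x l 0) ^+ 2 - cabs (y l 0) ^+ 2|.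
Proof.
by rewrite /correlation addr0 !vec_at_ord // -!cabs_sqr -rmorphB cabs_real.
Qed.

Lemma correlation1E x (l : 'I_L) :
  correlation (vec_at x) 1 l%:Z = x (ordS l) 0 * (x l 0)^*.
Proof.
rewrite /correlation vec_at_ord //; congr (_ * _).
rewrite -vec_at_ord //; apply: periodic_congr; first exact: vec_at_periodic.
by rewrite /= addrC -intS !modz_nat modn_mod.
Qed.

(** The phase is the relative phase at the middle of the arc. Each edge contributes at most
    [2 / delta ^+ 2] times the lag-one difference, so the squared distance to the middle is at most
    [q / 2 * (2 / delta ^+ 2) ^+ 2 * K ^+ 2] with [q = #|S|]. *)
Lemma exists_global_phase (delta K : R) x y :
    let S := ess_vertices delta x :&: supp y in
    0 < delta -> 0 <= K -> induced_connected (ess_edge delta x) S ->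
    \sum_(l < L) cabs (correlation (vec_at x) 1 l%:Z -
                       correlation (vec_at y) 1 l%:Z) ^+ 2 <= K ^+ 2 ->
  exists alpha, forall l, l \in S ->
    cabs (relative_phase (x l 0) (y l 0) - cis alpha) <=
    Num.sqrt (2 * #|S|%:R) / delta ^+ 2 * K.
Proof.
move=> S delta0 K0 conn sumD.
have [S0|Sn0] := eqVneq S finset.set0.
  by exists 0 => l; rewrite S0 inE.
have [a [uniq_s sE]] :=
  cyclic_connected_arc (@ess_edge_ordS L R delta x) conn Sn0.
set q := #|S| in uniq_s sE *.
have q_gt0 : (0 < q)%N by rewrite card_gt0.
pose T t := iter t (@ordS L) a.
have TS t : (t < q)%N -> T t \in S.
  by move=> tq; rewrite -sE; apply/trajectP; exists t.
have S_large l : l \in S -> delta <= cabs (x l 0).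
  by rewrite finset.in_setI inE => /andP[].
have S_nz l : l \in S -> y l 0 != 0.
  by rewrite finset.in_setI [_ \in supp y]inE => /andP[].
pose u t := relative_phase (x (T t) 0) (y (T t) 0).
pose D (l : 'I_L) := cabs (correlation (vec_at x) 1 l%:Z -
                       correlation (vec_at y) 1 l%:Z).
have u_step t : (t.+1 < q)%N ->
    cabs (u t.+1 - u t) <= 2 / delta ^+ 2 * D (T t).
  move=> tq; rewrite /D !correlation1E.
  by apply: relative_phase_dist => //; rewrite ?S_large ?S_nz ?TS // ltnW.
have sum_arc : \sum_(t < q) D (T t) ^+ 2 <= K ^+ 2.
  apply: le_trans sumD.
  have -> : \sum_(t < q) D (T t) ^+ 2 =
      \sum_(l <- traject (@ordS L) a q) D l ^+ 2.
    rewrite (big_nth a) size_traject big_mkord.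
    by apply: eq_bigr => t _; rewrite nth_traject.
  rewrite big_uniq // [leRHS](bigID (mem (traject (@ordS L) a q))) /= lerDl.
  by apply: sumr_ge0 => l _; exact: sqr_ge0.
have mid : T q./2 \in S by apply: TS; lia.
have center1 : cabs (u q./2) = 1.
  rewrite cabs_relative_phase ?S_nz // -cabs_eq0 gt_eqF //.
  exact: lt_le_trans delta0 (S_large _ mid).
have [alpha alphaE] := cis_surj center1.
exists alpha => l; rewrite -sE => /trajectP[i iq ->]; rewrite -/(T i) -/(u i).
rewrite -alphaE.
have rhs0 : 0 <= Num.sqrt (2 * q%:R) / delta ^+ 2 * K.
  by rewrite mulr_ge0 // divr_ge0 ?sqrtr_ge0 ?sqr_ge0.
rewrite -(@ler_pXn2r _ 2) ?nnegrE ?cabs_ge0 //.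
apply: le_trans (sqr_cabs_center_dist iq u_step) _.
under eq_bigr do rewrite exprMn.
rewrite -mulr_sumr mulrA [leRHS]exprMn [X in _ <= X * _]expr_div_n.
rewrite sqr_sqrtr ?mulr_ge0 ?ler0n //.
have -> : q%:R / 2 * (2 / delta ^+ 2) ^+ 2 =
    2 * q%:R / (delta ^+ 2) ^+ 2.
  by field; rewrite gt_eqF.
by rewrite ler_wpM2l // divr_ge0 ?sqr_ge0 // mulr_ge0 ?ler0n.
Qed.

(** The difference of squared moduli factors, and the sum of the moduli is at least [delta]; this
    bounds the radial error. At a vertex outside [S] the entry of [y] is 0 and no angular error
    arises. *)
Lemma cabs_sub_le (delta K alpha : R) x y (l : 'I_L) :
    let S := ess_vertices delta x :&: supp y in
    0 < delta -> 0 <= K -> l \in ess_vertices delta x ->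
    (l \in S -> cabs (relative_phase (x l 0) (y l 0) - cis alpha) <= K) ->
  cabs ((x - cis alpha *: y) l 0) <=
  `|cabs (x l 0) ^+ 2 - cabs (y l 0) ^+ 2| / delta +
  (if l \in S then cabs (x l 0) * K else 0).
Proof.
move=> S delta0 K0 lV hK.
have large : delta <= cabs (x l 0) by move: lV; rewrite inE.
have x0 := le_trans (ltW delta0) large.
have modulus : `|cabs (x l 0) - cabs (y l 0)| <=
    `|cabs (x l 0) ^+ 2 - cabs (y l 0) ^+ 2| / delta.
  rewrite ler_pdivlMr // subr_sqr normrM ler_wpM2l //.
  rewrite ger0_norm ?addr_ge0 ?cabs_ge0 //.
  by apply: le_trans large _; rewrite lerDl cabs_ge0.
rewrite !mxE; have [lS|lnS] := boolP (l \in S).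
  have y0 : y l 0 != 0.
    by move: lS; rewrite finset.in_setI [_ \in supp y]inE => /andP[].
  apply: le_trans (dist_phase_le _ y0 (cabs_cis alpha)) _.
  by apply: lerD => //; rewrite ler_wpM2l // hK.
have y0 : y l 0 = 0.
  by move: lnS; rewrite finset.in_setI lV [_ \in supp y]inE negbK => /eqP.
rewrite y0 mulr0 subr0 addr0; move: modulus.
by rewrite y0 cabs0 subr0 ger0_norm.
Qed.

End Synchronisation.

Theorem theorem3p6 (R : realType) (L : nat) (hL : (0 < L)%N)
    (delta : R) (hdelta : 0 < delta)
    (B : nat) (x y : 'cV[R[i]]_L)
    (hx : bandlimited B x) (hy : bandlimited B y)
    (hconn : induced_connected (ess_edge delta x)
               (ess_vertices delta x :&: supp y)%SET)
    (phi : 'cV[R[i]]_L) (c : R) (hc : 0 < c)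
    (hphi : forall m n : int, (m == 0) || (m == 1) ->
       - (2 * B)%:Z <= n <= (2 * B)%:Z ->
       1 / c <= cabs (mx_at (ambiguity phi) m n)) :
  inf [set l2norm (ess_vertices delta x) (x - cis alpha *: y)
        | alpha in [set: R]] <=
  c / delta *
  (1 + Num.sqrt (2 * #|(ess_vertices delta x :&: supp y)%SET|%:R)
       * l2norm (ess_vertices delta x :&: supp y)%SET x / delta) *
  frobenius (measurements phi x - measurements phi y).
Proof.
set V := ess_vertices delta x; set S := (V :&: supp y)%SET.
set F := frobenius _.
have F0 : 0 <= F by exact: sqrtr_ge0.
have cF0 : 0 <= c * F by rewrite mulr_ge0 // ltW.
have sum0 := sum_correlation_diff_le hL hx hy hc (hphi 0 ^~ isT).
have sum1 := sum_correlation_diff_le hL hx hy hc (hphi 1 ^~ isT).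
have [alpha phase] := exists_global_phase hL hdelta cF0 hconn sum1.
pose K := Num.sqrt (2 * #|S|%:R) / delta ^+ 2 * (c * F).
have K0 : 0 <= K by rewrite mulr_ge0 // divr_ge0 ?sqrtr_ge0 ?sqr_ge0.
(* The infimum is at most the value at [alpha], the set of norms being bounded below by 0. *)
apply: (@le_trans _ _ (l2norm V (x - cis alpha *: y))).
  apply: ge_inf; last by exists alpha.
  by exists 0 => _ [beta _ <-]; exact: sqrtr_ge0.
pose A l := `|cabs (x l 0) ^+ 2 - cabs (y l 0) ^+ 2| / delta.
pose Q l := if l \in S then cabs (x l 0) * K else 0.
have Q0 l : 0 <= Q l.
  by rewrite /Q; case: ifP => // _; rewrite mulr_ge0 ?cabs_ge0.
have A0 l : 0 <= A l by rewrite divr_ge0 // ltW.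
apply: (@le_trans _ _ (Num.sqrt (\sum_(l in V) (A l + Q l) ^+ 2))).
  rewrite ler_wsqrtr //; apply: ler_sum => l lV.
  rewrite lerXn2r ?nnegrE ?cabs_ge0 ?addr_ge0 //.
  exact: (cabs_sub_le hdelta K0 lV (phase l)).
apply: le_trans (sqrt_sum_sqrD_le _ _ _ _) _.
(* Radial part: the lag-zero estimate, restricted from all indices to [V]. *)
have A_le : Num.sqrt (\sum_(l in V) A l ^+ 2) <= c / delta * F.
  rewrite -[leRHS]ger0_norm; last by rewrite mulr_ge0 // divr_ge0 // ltW.
  rewrite -sqrtr_sqr ler_wsqrtr // mulrAC expr_div_n ler_pdivlMr ?exprn_gt0 //.
  apply: le_trans sum0; rewrite mulr_suml.
  apply: (@le_trans _ _ (\sum_(l in V)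
      `|cabs (x l 0) ^+ 2 - cabs (y l 0) ^+ 2| ^+ 2)).
    by apply: ler_sum => l _; rewrite expr_div_n divfK // expf_neq0 // gt_eqF.
  rewrite [leRHS](bigID (mem V)) /=.
  under [X in _ <= X + _]eq_bigr do rewrite correlation0_diff //.
  by rewrite lerDl; apply: sumr_ge0 => l _; exact: sqr_ge0.
(* Angular part: the summands vanish off [S], and [K] is uniform on [S]. *)
have Q_le : Num.sqrt (\sum_(l in V) Q l ^+ 2) <= l2norm S x * K.
  rewrite -[leRHS]ger0_norm; last by rewrite mulr_ge0 // sqrtr_ge0.
  rewrite -sqrtr_sqr ler_wsqrtr //.
  rewrite exprMn sqr_sqrtr; last by apply: sumr_ge0 => l _; exact: sqr_ge0.
  rewrite mulr_suml (bigID (mem S)) /= [X in _ + X]big1 ?addr0; last first.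
    by move=> l /andP[_ /negbTE lS]; rewrite /Q lS expr0n.
  rewrite (eq_bigl (fun l => l \in S)) => [|l]; last first.
    by rewrite /S !inE; case: (_ <= _); rewrite //= andbT.
  by apply: ler_sum => l lS; rewrite /Q lS exprMn.
apply: le_trans (lerD A_le Q_le) _.
(* The sum of the two bounds equals the right-hand side exactly. *)
rewrite le_eqVlt; apply/orP; left; apply/eqP; rewrite /K.
by field; rewrite gt_eqF.
Qed.
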